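(* Let $d \in (0,\frac{\pi}{2})$ and let $f$ be a function of the form $$f(x) = \frac{g(x)}{h(x)},$$ where: (i) $f$ is analytic in $\psi(\mathcal{D}_d)$; (ii) $g$ has only a finite number of singularities in the complex plane, i.e. there is a finite set $\Sigma \subset \mathbb{C}$ such that $g$ is analytic on $\mathbb{C}\setminus\Sigma$, and $g$ is continuous on $[-1,1]$ (that is, continuous, as a function of a complex variable, at every point of $[-1,1]$); (iii) there is a constant $C_1>0$ such that $|h(x)| \geq C_1 \left|\sqrt{1-x^2}\right|$ for all $x \in \psi(\mathcal{D}_d)$. Then $f$ satisfies the tanh-sinh conditions: there exist $d' \in (0,\frac{\pi}{2})$, $C>0$ and $\beta>0$ such that $f$ is analytic in $\psi(\mathcal{D}_{d'})$ and $$|f(z)| \leq C\,\left|(1-z^2)^{\beta/2-1}\right| \quad \text{for all } z \in \psi(\mathcal{D}_{d'}).$$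
   Context: For a real number $d$, $\mathcal{D}_d = \{z \in \mathbb{C} : |\operatorname{Im} z| < d\}$ is the open strip around the real axis. The tanh-sinh transformation is $\psi(z) = \tanh\left(\frac{\pi}{2}\sinh z\right)$, and $\psi(\mathcal{D}_d) = \{\psi(z) : z \in \mathcal{D}_d\}$ is the image of the strip. Moduli of powers are independent of the branch: $\left|\sqrt{1-x^2}\right| = |1-x^2|^{1/2}$ and $\left|(1-z^2)^{\beta/2-1}\right| = |1-z^2|^{\beta/2-1}$ for real $\beta$ (note $\psi$ does not take the values $\pm 1$ on $\mathcal{D}_d$ for $0<d<\pi/2$). *)

(* Defs.v *)
From Stdlib Require Import Reals List.
From Coquelicot Require Import Coquelicot.
Open Scope R_scope.

Definition Cexp (z : C) : C :=
  (exp (Re z) * cos (Im z), exp (Re z) * sin (Im z)).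

Definition Csinh (z : C) : C := ((Cexp z - Cexp (- z)) / 2)%C.

Definition Ccosh (z : C) : C := ((Cexp z + Cexp (- z)) / 2)%C.

Definition Ctanh (z : C) : C := (Csinh z / Ccosh z)%C.

Definition strip (d : R) (z : C) : Prop := Rabs (Im z) < d.

Definition psi (z : C) : C := Ctanh (RtoC (PI / 2) * Csinh z)%C.

Definition psi_strip (d : R) (z : C) : Prop :=
  exists w : C, strip d w /\ z = psi w.

Definition unit_segment (z : C) : Prop :=
  exists x : R, -1 <= x <= 1 /\ z = RtoC x.

Definition analytic_at (f : C -> C) (z0 : C) : Prop :=
  exists (a : nat -> C) (r : R), 0 < r /\
    forall z : C, Cmod (z - z0)%C < r ->
      @is_pseries C_AbsRing C_NormedModule a (z - z0)%C (f z).

Definition analytic_in (U : C -> Prop) (f : C -> C) : Prop :=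
  forall z : C, U z -> analytic_at f z.

(* [Rpower 0 _] has a junk value, but the base never vanishes here: [psi] omits
   the values 1 and -1 on a strip of half-width less than PI / 2. *)
Definition tanh_sinh_conditions (f : C -> C) : Prop :=
  exists d M beta : R,
    0 < d < PI / 2 /\ 0 < M /\ 0 < beta /\
    analytic_in (psi_strip d) f /\
    forall z : C, psi_strip d z ->
      Cmod (f z) <= M * Rpower (Cmod (1 - z * z)%C) (beta / 2 - 1).

(* Main.v *)
(** A thin strip is mapped by [psi] into a thin box around [-1, 1]: if
    [psi w = tanh u], then either [|Re u|] is large and [tanh u] is close to 1
    or -1, or [|Re w|] is bounded and then [Im u] is small. Continuity of [g] and
    compactness of [-1, 1] bound [g] by a constant on such a box, and a small
    enough box contains no singularity outside [-1, 1]. Hence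
    [|f| = |g / h| <= M |1 - z^2|^(-1/2)], i.e. [beta = 1]. *)

Require Import Defs.
From Stdlib Require Import Reals List Lra.
From Stdlib Require Import ClassicalEpsilon.
From Coquelicot Require Import Coquelicot.
Open Scope R_scope.

(** * Real inequalities for the hyperbolic and circular functions *)

Lemma cosh_sqr (a : R) : cosh a * cosh a = 1 + sinh a * sinh a.
Proof.
  unfold cosh, sinh.
  assert (H : exp a * exp (- a) = 1)
    by (rewrite <- exp_plus, Rplus_opp_r; apply exp_0).
  nra.
Qed.

Lemma cosh_ge_1 (a : R) : 1 <= cosh a.
Proof.
  assert (H : 0 < cosh a)
    by (unfold cosh; pose proof (exp_pos a); pose proof (exp_pos (- a)); lra).
  pose proof (cosh_sqr a); nra.
Qed.

Lemma sinh_opp (a : R) : sinh (- a) = - sinh a.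
Proof. unfold sinh; rewrite Ropp_involutive; lra. Qed.

(** For [t >= 0], [exp t >= 1 + t] and [exp (- t) <= 1] give [2 * sinh t >= t]; oddness covers the
    rest. *)
Lemma sinh_sqr_ge (a : R) : a * a <= 4 * (sinh a * sinh a).
Proof.
  assert (P : forall t, 0 <= t -> t <= 2 * sinh t).
  { intros t Ht; unfold sinh.
    pose proof (exp_ineq1_le t).
    assert (exp (- t) <= 1).
    { rewrite <- exp_0; destruct Ht as [Ht | <-].
      - left; apply exp_increasing; lra.
      - rewrite Ropp_0; lra. }
    lra. }
  destruct (Rle_dec 0 a) as [Ha | Ha].
  - pose proof (P a Ha); nra.
  - assert (H : - a <= 2 * sinh (- a)) by (apply P; lra).
    rewrite sinh_opp in H; nra.
Qed.

Lemma sin_sqr_le (y : R) : sin y * sin y <= y * y.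
Proof.
  assert (P : forall t, 0 <= t -> sin t * sin t <= t * t).
  { intros t [Ht | <-]; [ | rewrite sin_0; lra].
    destruct (Rle_dec t 1) as [H1 | H1].
    - pose proof (sin_lt_x t Ht).
      assert (0 <= sin t) by (apply sin_ge_0; pose proof PI2_1; lra).
      nra.
    - pose proof (SIN_bound t); nra. }
  destruct (Rle_dec 0 y) as [Hy | Hy]; [auto | ].
  assert (H : sin (- y) * sin (- y) <= - y * - y) by (apply P; lra).
  rewrite sin_neg in H; lra.
Qed.

Lemma cos_sqr (y : R) : cos y * cos y = 1 - sin y * sin y.
Proof. pose proof (sin2_cos2 y) as H; unfold Rsqr in H; lra. Qed.

(** * Real and imaginary parts of the complex hyperbolic functions *)

Lemma Csinh_eq (a b : R) : Csinh (a, b) = (sinh a * cos b, cosh a * sin b).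
Proof.
  unfold Csinh, Cexp, sinh, cosh; apply injective_projections; simpl;
    rewrite ?cos_neg, ?sin_neg; field.
Qed.

Lemma Ccosh_eq (a b : R) : Ccosh (a, b) = (cosh a * cos b, sinh a * sin b).
Proof.
  unfold Ccosh, Cexp, sinh, cosh; apply injective_projections; simpl;
    rewrite ?cos_neg, ?sin_neg; field.
Qed.

(** [D] is the squared modulus of [Ccosh (a, b)], so its positivity says that [Ctanh] has no pole
    there. *)
Lemma Ctanh_eq (a b : R) (D := sinh a * sinh a + cos b * cos b) :
  0 < D ->
  Ctanh (a, b) = (sinh a * cosh a / D, sin b * cos b / D).
Proof.
  intros HD; unfold Ctanh; rewrite Csinh_eq, Ccosh_eq.
  assert (E : (cosh a * cos b) ^ 2 + (sinh a * sin b) ^ 2 = D).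
  { pose proof (cosh_sqr a); pose proof (cos_sqr b); unfold D; nra. }
  unfold Cdiv, Cinv, Cmult; apply injective_projections; simpl in *;
    rewrite E.
  - pose proof (cos_sqr b) as Hb.
    replace (sinh a * cosh a / D)
      with (sinh a * cosh a * (cos b * cos b + sin b * sin b) / D)
      by (rewrite Hb; field; lra).
    field; lra.
  - pose proof (cosh_sqr a) as Ha.
    replace (sin b * cos b / D)
      with (sin b * cos b * (cosh a * cosh a - sinh a * sinh a) / D)
      by (rewrite Ha; field; lra).
    field; lra.
Qed.

Lemma psi_eq (x y : R) :
  psi (x, y) = Ctanh (PI / 2 * (sinh x * cos y), PI / 2 * (cosh x * sin y)).
Proof.
  unfold psi; rewrite Csinh_eq; f_equal.
  apply injective_projections; simpl; ring.
Qed.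

Lemma Ctanh_sqr_neq_1 (a b : R) :
  0 < sinh a * sinh a + cos b * cos b ->
  (1 - Ctanh (a, b) * Ctanh (a, b))%C <> 0%C.
Proof.
  intros HD H; rewrite Ctanh_eq in H by exact HD.
  set (D := sinh a * sinh a + cos b * cos b) in *.
  apply (f_equal (fun z : C => (fst z, snd z))) in H; simpl in H.
  injection H as H1 H2.
  set (p := sinh a * cosh a / D) in *; set (q := sin b * cos b / D) in *.
  assert (Hpq : q = 0) by nra.
  assert (Hp : p * p = 1) by nra.
  assert (Ep : p * D = sinh a * cosh a) by (unfold p; field; lra).
  assert (Eq : q * D = sin b * cos b) by (unfold q; field; lra).
  rewrite Hpq, Rmult_0_l in Eq.
  assert (E2 : D * D = sinh a * sinh a * (1 + sinh a * sinh a)).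
  { rewrite <- cosh_sqr.
    replace (D * D) with (p * p * (D * D)) by (rewrite Hp; ring).
    replace (p * p * (D * D)) with ((p * D) * (p * D)) by ring.
    rewrite Ep; ring. }
  pose proof (cos_sqr b) as Hb.
  (* If [sin b = 0], then [D] is [cosh a] squared, against [E2]; if [cos b = 0], then [E2] forces
     [sinh a = 0], hence [D = 0]. *)
  destruct (Rmult_integral _ _ (eq_sym Eq)) as [E | E]; unfold D in *;
    rewrite E in *; nra.
Qed.

(** * Thin strips are mapped into thin boxes around [-1, 1] *)

Definition near_segment (e : R) (z : C) : Prop :=
  Rabs (fst z) < 1 + e /\ Rabs (snd z) < e.

Lemma sinh_cosh_le (a : R) : Rabs (sinh a * cosh a) <= sinh a * sinh a + 1 / 2.
Proof. pose proof (cosh_sqr a); apply Rabs_le; split; nra. Qed.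

Lemma Rabs_div_lt (p q c : R) : 0 < q -> Rabs p < c * q -> Rabs (p / q) < c.
Proof.
  intros Hq H; unfold Rdiv.
  rewrite Rabs_mult, Rabs_inv, (Rabs_pos_eq q) by lra.
  apply Rlt_div_l; lra.
Qed.

(** The denominator is at least [1 / e], while the numerators are at most [sinh a * sinh a + 1 / 2]
    and [1 / 2] in absolute value. *)
Lemma Ctanh_near_segment_sinh (a b e : R) :
  0 < e -> 1 <= e * (sinh a * sinh a) ->
  0 < sinh a * sinh a + cos b * cos b /\ near_segment e (Ctanh (a, b)).
Proof.
  intros He H.
  assert (Hs : 0 < sinh a * sinh a) by nra.
  pose proof (cos_sqr b) as Hb.
  assert (HD : 0 < sinh a * sinh a + cos b * cos b) by nra.
  split; [exact HD | ].
  rewrite Ctanh_eq by exact HD; split; simpl; apply Rabs_div_lt; try exact HD.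
  - pose proof (sinh_cosh_le a); nra.
  - pose proof (Rle_0_sqr (sin b + cos b)) as Hp.
    pose proof (Rle_0_sqr (sin b - cos b)) as Hm.
    unfold Rsqr in Hp, Hm.
    apply Rle_lt_trans with (1 / 2); [apply Rabs_le; split; lra | nra].
Qed.

(** A small [sin b] keeps the denominator above 1/2, away from the poles, so the imaginary part is
    below [2 * Rabs (sin b)]. *)
Lemma Ctanh_near_segment_sin (a b e : R) :
  Rabs (sin b) <= 1 / 2 -> 2 * Rabs (sin b) < e ->
  0 < sinh a * sinh a + cos b * cos b /\ near_segment e (Ctanh (a, b)).
Proof.
  intros H1 H2.
  pose proof (Rabs_pos (sin b)) as H0.
  assert (Hs : sin b * sin b = Rabs (sin b) * Rabs (sin b))
    by (rewrite <- Rabs_mult, Rabs_pos_eq; nra).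
  pose proof (cos_sqr b) as Hb.
  assert (Hc : 1 / 2 < cos b * cos b) by nra.
  assert (HD : 1 / 2 < sinh a * sinh a + cos b * cos b) by nra.
  split; [lra | ].
  rewrite Ctanh_eq by lra; split; simpl; apply Rabs_div_lt; try lra.
  - pose proof (sinh_cosh_le a); nra.
  - rewrite Rabs_mult.
    assert (Rabs (cos b) <= 1) by (apply Rabs_le, COS_bound).
    nra.
Qed.

Lemma psi_strip_near_segment (e : R) :
  0 < e ->
  exists d, 0 < d /\ forall z, psi_strip d z ->
    (1 - z * z)%C <> 0%C /\ near_segment e z.
Proof.
  intros He.
  (* Threshold for [sinh x] squared: the factor 8 absorbs a 2 from [cos y] squared being at least
     1/2 and a 4 from [sinh_sqr_ge]. *)
  set (K := 8 / e).
  assert (HK : 0 < K) by (apply Rdiv_lt_0_compat; lra).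
  set (m := Rmin (1 / 2) (e / 2)).
  assert (Hm : 0 < m) by (apply Rmin_pos; lra).
  assert (Hm1 : m <= 1 / 2) by apply Rmin_l.
  assert (Hm2 : m <= e / 2) by apply Rmin_r.
  (* Below the threshold [cosh x <= K + 1], so [Rabs b <= 2 * (K + 1) * Rabs y], which this width
     makes less than [m]. *)
  exists (m / (2 * (K + 1))).
  assert (Hd : 0 < m / (2 * (K + 1))) by (apply Rdiv_lt_0_compat; lra).
  split; [exact Hd | ].
  intros z [[x y] [Hy ->]]; unfold strip in Hy; simpl in Hy.
  apply Rlt_div_r in Hy; [ | lra].
  rewrite psi_eq.
  set (a := PI / 2 * (sinh x * cos y)); set (b := PI / 2 * (cosh x * sin y)).
  cut (0 < sinh a * sinh a + cos b * cos b /\ near_segment e (Ctanh (a, b))).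
  { intros [HD H]; split; [apply Ctanh_sqr_neq_1; exact HD | exact H]. }
  pose proof PI2_1 as HPI1; pose proof PI_4 as HPI2.
  pose proof (Rabs_pos y) as Hy0.
  assert (Hyy : y * y = Rabs y * Rabs y)
    by (rewrite <- Rabs_mult, Rabs_pos_eq; nra).
  pose proof (sin_sqr_le y) as Hsy.
  destruct (Rle_dec K (sinh x * sinh x)) as [Hx | Hx].
  - apply Ctanh_near_segment_sinh; [exact He | ].
    pose proof (sinh_sqr_ge a) as Ha.
    assert (Hc : 1 / 2 <= cos y * cos y) by (rewrite cos_sqr; nra).
    assert (HP : 1 <= PI / 2 * (PI / 2)) by nra.
    assert (Ha2 : K / 2 <= a * a).
    { replace (a * a)
        with ((PI / 2 * (PI / 2)) * ((sinh x * sinh x) * (cos y * cos y)))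
        by (unfold a; ring).
      assert (K / 2 <= (sinh x * sinh x) * (cos y * cos y)) by nra.
      nra. }
    assert (HKe : e * K = 8) by (unfold K; field; lra).
    nra.
  - assert (Hb : Rabs (sin b) < m).
    { pose proof (cosh_ge_1 x) as Hc1; pose proof (cosh_sqr x) as Hc2.
      assert (Hc : cosh x <= K + 1) by nra.
      assert (Hsb : Rabs (sin b) <= Rabs b)
        by (apply Rsqr_le_abs_0; exact (sin_sqr_le b)).
      assert (Hsy' : Rabs (sin y) <= Rabs y)
        by (apply Rsqr_le_abs_0; exact Hsy).
      assert (Hb : Rabs b <= 2 * (K + 1) * Rabs y).
      { unfold b; rewrite !Rabs_mult, (Rabs_pos_eq (PI / 2)) by lra.
        rewrite (Rabs_pos_eq (cosh x)) by lra.
        pose proof (Rabs_pos (sin y)).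
        replace (2 * (K + 1) * Rabs y) with (2 * ((K + 1) * Rabs y)) by ring.
        apply Rmult_le_compat; try lra; [nra | ].
        apply Rmult_le_compat; lra. }
      lra. }
    apply Ctanh_near_segment_sin; lra.
Qed.

(** * Behaviour of [g] and its singularities near [-1, 1] *)

Lemma bounded_near_segment (g : C -> C) :
  (forall x : R, -1 <= x <= 1 ->
     @continuous C_UniformSpace C_UniformSpace g (RtoC x)) ->
  exists e M, 0 < e /\ 0 < M /\
    forall z, near_segment e z -> Cmod (g z) <= M.
Proof.
  intros Hg.
  (* A single number [r] gives both a radius and the bound [/ r], so one uniform lower bound on [r]
     will control both. The factor 2 leaves room for a triangle inequality. *)
  assert (Hloc : forall t : R, exists r : posreal, -1 <= t <= 1 ->
    forall z : C, Rabs (fst z - t) < 2 * r -> Rabs (snd z) < 2 * r ->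
      Cmod (g z) <= / r).
  { intros t.
    destruct (classic (-1 <= t <= 1)) as [Ht | Ht];
      [ | exists (mkposreal 1 Rlt_0_1); intros; contradiction].
    destruct (proj1 (filterlim_locally _ _) (Hg t Ht) (mkposreal 1 Rlt_0_1))
      as [r Hr]; simpl in Hr.
    (* Each coordinate of [g z - g t] is less than 1, so its modulus is at most [sqrt 2 <= 2]. *)
    set (N := Cmod (g t) + 2).
    assert (HN : 0 < N) by (pose proof (Cmod_ge_0 (g t)); unfold N; lra).
    assert (Hr' : 0 < Rmin (r / 2) (/ N))
      by (apply Rmin_pos; [destruct r; simpl; lra | apply Rinv_0_lt_compat, HN]).
    exists (mkposreal _ Hr'); simpl; intros _ z H1 H2.
    pose proof (Rmin_l (r / 2) (/ N)); pose proof (Rmin_r (r / 2) (/ N)).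
    apply Rle_trans with N.
    - destruct (Hr z) as [B1 B2].
      { split; unfold ball; simpl; unfold AbsRing_ball, abs, minus, plus, opp;
          simpl; [ | rewrite Ropp_0, Rplus_0_r]; unfold Rminus in H1; lra. }
      unfold ball in B1, B2; simpl in B1, B2.
      unfold AbsRing_ball, abs, minus, plus, opp in B1, B2; simpl in B1, B2.
      replace (g z) with (g t + (g z - g t))%C by ring.
      eapply Rle_trans; [apply Cmod_triangle | ].
      unfold N; apply Rplus_le_compat_l.
      eapply Rle_trans; [apply Cmod_2Rmax | ].
      assert (Hm : Rmax (Rabs (fst (g z - g t)%C)) (Rabs (snd (g z - g t)%C)) <= 1)
        by (apply Rmax_lub; simpl; lra).
      assert (H2s : sqrt 2 <= 2)
        by (rewrite <- (sqrt_square 2) at 2 by lra; apply sqrt_le_1_alt; lra).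
      pose proof (sqrt_pos 2).
      assert (0 <= Rmax (Rabs (fst (g z - g t)%C)) (Rabs (snd (g z - g t)%C)))
        by (eapply Rle_trans; [apply Rabs_pos | apply Rmax_l]).
      nra.
    - rewrite <- (Rinv_inv N) at 1; apply Rinv_le_contravar; assumption. }
  pose (delta t := proj1_sig (constructive_indefinite_description _ (Hloc t))).
  assert (Hdelta : forall t, -1 <= t <= 1 ->
    forall z : C, Rabs (fst z - t) < 2 * delta t -> Rabs (snd z) < 2 * delta t ->
      Cmod (g z) <= / delta t)
    by (intros t; exact (proj2_sig (constructive_indefinite_description _ (Hloc t)))).
  destruct (compactness_value_1d (-1) 1 delta) as [r Hr].
  exists r, (/ r); split; [apply cond_pos | ].
  split; [apply Rinv_0_lt_compat, cond_pos | ].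
  intros z [Hz1 Hz2].
  (* [x] is the real part of [z] clamped to [-1, 1]. *)
  assert (Hx : exists x, -1 <= x <= 1 /\ Rabs (fst z - x) < r).
  { apply Rabs_def2 in Hz1; pose proof (cond_pos r).
    destruct (Rle_dec (fst z) (-1)); [exists (-1) | destruct (Rle_dec (fst z) 1);
      [exists (fst z) | exists 1]]; (split; [lra | apply Rabs_def1; lra]). }
  destruct Hx as [x [Hx Hzx]].
  (* Compactness yields the centre [t] only under a double negation, removed because the goal is a
     proposition. *)
  apply NNPP; intros Hn; apply (Hr x Hx); intros [t [Ht [Hxt Hrt]]]; apply Hn.
  pose proof (cond_pos r).
  apply Rle_trans with (/ delta t).
  - apply Hdelta; [exact Ht | | lra].
    replace (fst z - t) with ((fst z - x) + (x - t)) by ring.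
    eapply Rle_lt_trans; [apply Rabs_triang | lra].
  - apply Rinv_le_contravar; lra.
Qed.

(** A point off [-1, 1] is excluded by some box, and finitely many such boxes have a smallest
    width. *)
Lemma near_segment_avoids (sing : list C) :
  exists e, 0 < e /\
    forall z, near_segment e z -> ~ In z sing \/ unit_segment z.
Proof.
  induction sing as [ | [p q] l [e [He IH]]].
  { exists 1; split; [lra | left; intros []]. }
  assert (Hs : unit_segment (p, q) \/
    exists e', 0 < e' /\ ~ near_segment e' (p, q)).
  { destruct (Req_dec q 0) as [-> | Hq].
    - destruct (Rle_dec (Rabs p) 1) as [Hp | Hp].
      + left; exists p; split; [apply Rabs_le_between, Hp | reflexivity].
      + right; exists (Rabs p - 1); split; [lra | intros [H _]; simpl in H; lra].
    - right; exists (Rabs q); split; [apply Rabs_pos_lt, Hq | ].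
      intros [_ H]; simpl in H; lra. }
  destruct Hs as [Hs | [e' [He' Hs]]].
  - exists e; split; [exact He | ]; intros z Hz.
    destruct (IH z Hz) as [H | H]; [ | right; exact H].
    destruct (classic (z = (p, q))) as [-> | Hn]; [right; exact Hs | left].
    intros [E | E]; [apply Hn; symmetry; exact E | exact (H E)].
  - exists (Rmin e e'); split; [apply Rmin_pos; assumption | ].
    pose proof (Rmin_l e e'); pose proof (Rmin_r e e').
    intros z [Hz1 Hz2].
    destruct (IH z) as [H1 | H1]; [split; lra | left | right; exact H1].
    intros [E | E]; [apply Hs; rewrite E; split; lra | exact (H1 E)].
Qed.

(** * Assembling the bound on [f] *)

Lemma psi_strip_incl (d d' : R) (z : C) :
  d <= d' -> psi_strip d z -> psi_strip d' z.
Proof.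
  intros H [w [Hw E]]; exists w; split; [ | exact E].
  unfold strip in *; lra.
Qed.

(* Functions are total here, so the value of [g] at a point of [sing] outside
   [-1, 1] is meaningless; the identity f = g / h is therefore required only at
   the points of the domain of [f] where [g] is defined. *)
Theorem theorem2 (d : R) (f g h : C -> C) (sing : list C) (C1 : R)
  (hd : 0 < d < PI / 2)
  (hfgh : forall z : C, psi_strip d z -> ~ In z sing \/ unit_segment z ->
            f z = (g z / h z)%C)
  (hf : analytic_in (psi_strip d) f)
  (hg_sing : analytic_in (fun z : C => ~ In z sing) g)
  (hg_cont : forall x : R, -1 <= x <= 1 ->
               @continuous C_UniformSpace C_UniformSpace g (RtoC x))
  (hC1 : 0 < C1)
  (hh : forall z : C, psi_strip d z ->
          C1 * sqrt (Cmod (1 - z * z)%C) <= Cmod (h z)) :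
  tanh_sinh_conditions f.
Proof.
  destruct (bounded_near_segment g hg_cont) as [e1 [M [He1 [HM Hg]]]].
  destruct (near_segment_avoids sing) as [e2 [He2 Hsing]].
  destruct (psi_strip_near_segment (Rmin e1 e2)) as [d1 [Hd1 Hpsi]];
    [apply Rmin_pos; assumption | ].
  exists (Rmin d d1), (M / C1), 1.
  split; [split; [apply Rmin_pos; lra | apply Rle_lt_trans with d; [apply Rmin_l | lra]] | ].
  split; [apply Rdiv_lt_0_compat; assumption | ].
  split; [lra | ].
  split; [intros z Hz; apply hf; revert Hz; apply psi_strip_incl, Rmin_l | ].
  intros z Hz.
  assert (Hzd : psi_strip d z) by (revert Hz; apply psi_strip_incl, Rmin_l).
  destruct (Hpsi z) as [Hz0 [Hz1 Hz2]];
    [revert Hz; apply psi_strip_incl, Rmin_r | ].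
  pose proof (Rmin_l e1 e2); pose proof (Rmin_r e1 e2).
  assert (Hgz : Cmod (g z) <= M) by (apply Hg; split; lra).
  rewrite (hfgh z Hzd) by (apply Hsing; split; lra).
  specialize (hh z Hzd).
  apply Cmod_gt_0 in Hz0.
  set (r := Cmod (1 - z * z)%C) in *.
  pose proof (sqrt_lt_R0 r Hz0) as Hsr.
  (* As [1 - z * z] is nonzero, the lower bound on [h] keeps it from vanishing, so the quotient is a
     genuine one. *)
  assert (Hhz : 0 < Cmod (h z)) by nra.
  rewrite Cmod_div by (apply Cmod_gt_0; exact Hhz).
  replace (1 / 2 - 1) with (- / 2) by field.
  rewrite Rpower_Ropp, Rpower_sqrt by exact Hz0.
  apply Rle_trans with (M / (C1 * sqrt r)); [ | right; field; lra].
  apply Rmult_le_compat; [apply Cmod_ge_0 | left; apply Rinv_0_lt_compat, Hhz | exact Hgz | ].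
  apply Rinv_le_contravar; [nra | exact hh].
Qed.
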